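(* There exists a finitely presented homogeneous monoid $M=\langle A\mid\mathcal{R}\rangle$ in which the $o$-conjugacy problem is undecidable. That is, there is no algorithm that takes as input two words over $A$ and decides whether the elements of $M$ they represent are $o$-conjugate in $M$.
   Context: A monoid presentation $\langle A\mid\mathcal{R}\rangle$ (with $\mathcal{R}\subseteq A^*\times A^*$) presents the monoid $A^*/\equiv$, where $\equiv$ is the congruence generated by $\mathcal{R}$. It is homogeneous if $|u|=|v|$ (equal word length) for all $(u,v)\in\mathcal{R}$. A monoid is homogeneous if it can be defined by a homogeneous presentation. In the statement, $\langle A\mid\mathcal{R}\rangle$ is a homogeneous presentation with $A$ and $\mathcal{R}$ finite. For a monoid $M$ and $x,y\in M$, $x\sim_o y$ ($x$ and $y$ are $o$-conjugate) iff there exist $g,h\in M$ with $xg=gy$ and $hx=yh$. *)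

(* Defs.v *)
From HB Require Import structures.
From mathcomp Require Import all_boot.
From mathcomp Require Import boolp.

Set Implicit Arguments.
Unset Strict Implicit.
Unset Printing Implicit Defensive.

Local Open Scope group_scope.
Local Open Scope quotient_scope.

Notation word A := (seq A) (only parsing).

Definition homogeneous (A : eqType) (R : seq (word A * word A)) : Prop :=
  forall u v : word A, (u, v) \in R -> size u = size v.

Inductive congruence_gen (A : eqType) (R : seq (word A * word A)) :
    word A -> word A -> Prop :=
| cong_rel u v : (u, v) \in R -> congruence_gen R u v
| cong_refl u : congruence_gen R u u
| cong_sym u v : congruence_gen R u v -> congruence_gen R v u
| cong_trans u v w :
    congruence_gen R u v -> congruence_gen R v w -> congruence_gen R u w
| cong_cat u u' v v' :
    congruence_gen R u u' -> congruence_gen R v v' ->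
    congruence_gen R (u ++ v) (u' ++ v').

Section PresentedMonoid.
Variables (A : finType) (R : seq (word A * word A)).

Definition congb : rel (seq A) := fun u v => `[< congruence_gen R u v >].

Lemma congbP u v : reflect (congruence_gen R u v) (congb u v).
Proof. exact: asboolP. Qed.

Lemma congb_refl : reflexive congb.
Proof. by move=> u; apply/congbP/cong_refl. Qed.

Lemma congb_sym : symmetric congb.
Proof. by move=> u v; apply/congbP/congbP => /cong_sym. Qed.

Lemma congb_trans : transitive congb.
Proof.
move=> v u w /congbP uv /congbP vw.
by apply/congbP; apply: cong_trans uv vw.
Qed.

Canonical congb_equiv := EquivRel congb congb_refl congb_sym congb_trans.

Definition presented : Type := {eq_quot congb}.

HB.instance Definition _ := Choice.on presented.
HB.instance Definition _ := EqQuotient.on presented.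

Definition word_class (u : word A) : presented := \pi_presented u.

Lemma word_classP u v :
  word_class u = word_class v <-> congruence_gen R u v.
Proof.
by split=> [/eqquotP/congbP | uv] //; apply/eqquotP/congbP.
Qed.

Lemma word_class_surj (x : presented) : exists u, x = word_class u.
Proof. by exists (repr x); rewrite /word_class reprK. Qed.

Definition presented_one : presented := word_class [::].
Definition presented_mul (x y : presented) : presented :=
  word_class (repr x ++ repr y).

Lemma presented_mulE u v :
  presented_mul (word_class u) (word_class v) = word_class (u ++ v).
Proof.
by apply/word_classP/cong_cat; apply/word_classP; rewrite /word_class reprK.
Qed.

Lemma presented_mulA : associative presented_mul.
Proof.
move=> x y z; have [[u ->] [v ->] [w ->]] :=
  And3 (word_class_surj x) (word_class_surj y) (word_class_surj z).
by rewrite !presented_mulE catA.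
Qed.

Lemma presented_mul1 : left_id presented_one presented_mul.
Proof.
by move=> x; have [u ->] := word_class_surj x; rewrite presented_mulE.
Qed.

Lemma presented_mulr1 : right_id presented_one presented_mul.
Proof.
by move=> x; have [u ->] := word_class_surj x; rewrite presented_mulE cats0.
Qed.

HB.instance Definition _ :=
  isMonoid.Build presented presented_mulA presented_mul1 presented_mulr1.

Lemma word_class_cat u v : word_class (u ++ v) = word_class u * word_class v.
Proof. by rewrite -presented_mulE. Qed.

Lemma word_class_nil : word_class [::] = 1.
Proof. by []. Qed.

End PresentedMonoid.

Definition o_conjugate (M : monoidType) (x y : M) : Prop :=
  exists g h : M, x * g = g * y /\ h * x = y * h.

(* Deterministic single-tape Turing machines with a two-way infinite tape *)

Variant move := MoveLeft | MoveRight | Stay.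

Record turing_machine (S : finType) := TuringMachine {
  tm_state : finType;
  tm_symbol : finType;
  tm_blank : tm_symbol;
  tm_input : S -> tm_symbol;
  tm_input_inj : injective tm_input;
  tm_input_blank : forall a, tm_input a <> tm_blank;
  tm_start : tm_state;
  (* [None] means that the machine halts. *)
  tm_trans : tm_state -> tm_symbol -> option (tm_state * tm_symbol * move);
  tm_accept : pred tm_state
}.

(* [tape_left] is read from the head outwards, [tape_right] starts with the
   scanned cell; all cells beyond the two lists are blank. *)
Record config (S : finType) (T : turing_machine S) := Config {
  conf_state : tm_state T;
  tape_left : seq (tm_symbol T);
  tape_right : seq (tm_symbol T)
}.

Section TuringMachines.
Variables (S : finType) (T : turing_machine S).

Definition tm_init (w : seq S) : config T :=
  Config (tm_start T) [::] (map (@tm_input S T) w).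

Definition tm_step (c : config T) : option (config T) :=
  let: Config q l r := c in
  let b := tm_blank T in
  match tm_trans q (head b r) with
  | None => None
  | Some (q', a, MoveLeft) =>
      Some (Config q' (behead l) (head b l :: a :: behead r))
  | Some (q', a, MoveRight) => Some (Config q' (a :: l) (behead r))
  | Some (q', a, Stay) => Some (Config q' l (a :: behead r))
  end.

Definition tm_halts_in (w : seq S) (c : config T) : Prop :=
  (exists n : nat, iter n (obind tm_step) (Some (tm_init w)) = Some c) /\
  tm_step c = None.

End TuringMachines.

(* The pair (u, v) is written on the tape as u#v, the separator # being [None]. *)
Definition encode_pair (A : Type) (u v : word A) : seq (option A) :=
  map Some u ++ None :: map Some v.

Definition tm_decides (A : finType) (T : turing_machine (option A))
    (P : word A -> word A -> Prop) : Prop :=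
  forall u v : word A, exists c : config T,
    tm_halts_in (encode_pair u v) c /\ (tm_accept (conf_state c) <-> P u v).

Definition turing_decidable (A : finType)
    (P : word A -> word A -> Prop) : Prop :=
  exists T : turing_machine (option A), tm_decides T P.

(* Main.v *)
Require Import Defs.
From HB Require Import structures.
From mathcomp Require Import all_boot.
From mathcomp Require Import boolp.

(* A fixed monoid U interprets arbitrary finite presentations: a program word,
   which commutes with data words, lists the rules, and a cursor that crosses
   the text of a rule [u = v] erases [u] from the data and then writes [v].
   Hence, for the program P of a presentation, P x and P y are equal in U iff x
   and y are equal in the presented monoid.  A central padding letter makes U
   homogeneous, and x ~o y may absorb padding in g and h.  Counting the factors
   [Open w Close] with w equal to a given element shows that, for x and y of
   this form, o-conjugacy is equality up to padding.

   Given a Turing machine D that decides o-conjugacy, a presentation simulating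
   D is written that first copies its own program, supplied as data, onto the
   tape, so that D runs on the very pair of words that is being rewritten.  This
   pair is o-conjugate iff D rejects it. *)

Set Implicit Arguments.
Unset Strict Implicit.
Unset Printing Implicit Defensive.

(** * Congruences and actions of letters *)

Section Congruence.
Variables (A : eqType) (R : seq (word A * word A)).

Lemma cong_ctx (l r u v : seq A) :
  congruence_gen R u v -> congruence_gen R (l ++ u ++ r) (l ++ v ++ r).
Proof.
move=> uv; apply: cong_cat; first exact: cong_refl.
by apply: cong_cat => //; apply: cong_refl.
Qed.

Lemma cong_rel_ctx (l r u v : seq A) :
  (u, v) \in R -> congruence_gen R (l ++ u ++ r) (l ++ v ++ r).
Proof. by move=> uv; apply: cong_ctx; apply: cong_rel. Qed.

Lemma cong_size (u v : seq A) :
  homogeneous R -> congruence_gen R u v -> size u = size v.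
Proof.
move=> homR; elim=> {u v} [u v /homR //|//|u v _ -> //|u v w _ -> //|].
by move=> u u' v v' _ eu _ ev; rewrite !size_cat eu ev.
Qed.

(** Source of all invariants below: an action of the letters under which the two sides of each rule
    agree factors through the congruence, so it can separate words. *)
Lemma cong_foldr (S : Type) (op : A -> S -> S) :
  (forall u v s, (u, v) \in R -> foldr op s u = foldr op s v) ->
  forall u v, congruence_gen R u v -> forall s, foldr op s u = foldr op s v.
Proof.
move=> opR u v; elim=> {u v} [u v uv s|//|u v _ IH s|u v w _ IH1 _ IH2 s|].
- exact: opR.
- by rewrite IH.
- by rewrite IH1 IH2.
by move=> u u' v v' _ IHu _ IHv s; rewrite !foldr_cat IHu IHv.
Qed.

End Congruence.

Inductive pletter := Copy of bool | Start | Middle | Stop.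

Definition pletter_code (p : pletter) : bool + option bool :=
  match p with
  | Copy b => inl b
  | Start => inr None
  | Middle => inr (Some true)
  | Stop => inr (Some false)
  end.

Definition pletter_decode (x : bool + option bool) : pletter :=
  match x with
  | inl b => Copy b
  | inr None => Start
  | inr (Some true) => Middle
  | inr (Some false) => Stop
  end.

Lemma pletter_codeK : cancel pletter_code pletter_decode.
Proof. by case. Qed.

HB.instance Definition _ := Finite.copy pletter (can_type pletter_codeK).

(** * The universal monoid *)

Inductive uletter :=
  Data of bool | Prog of pletter | Eraser | Writer | Pad | Open | Close.

Definition uletter_code (x : uletter) : bool + pletter + option (bool * bool) :=
  match x with
  | Data b => inl (inl b)
  | Prog p => inl (inr p)
  | Eraser => inr (Some (true, true))
  | Writer => inr (Some (true, false))
  | Pad => inr (Some (false, true))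
  | Open => inr (Some (false, false))
  | Close => inr None
  end.

Definition uletter_decode (x : bool + pletter + option (bool * bool)) :=
  match x with
  | inl (inl b) => Data b
  | inl (inr p) => Prog p
  | inr (Some (true, true)) => Eraser
  | inr (Some (true, false)) => Writer
  | inr (Some (false, true)) => Pad
  | inr (Some (false, false)) => Open
  | inr None => Close
  end.

Lemma uletter_codeK : cancel uletter_code uletter_decode.
Proof. by case. Qed.

HB.instance Definition _ := Finite.copy uletter (can_type uletter_codeK).

(** Lengths are balanced by [Pad]: an erased letter becomes [Pad], a written one consumes [Pad], and
    a cursor arises from [Pad] after [Start] and turns back into [Pad] after [Stop]. *)
Definition universal_rel : seq (word uletter * word uletter) :=
  [seq ([:: Pad; x], [:: x; Pad]) | x <- enum {: uletter}] ++
  [seq ([:: Prog p; Data b], [:: Data b; Prog p])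
     | p <- enum {: pletter}, b <- enum {: bool}] ++
  [seq ([:: Eraser; Prog (Copy b); Data b], [:: Prog (Copy b); Eraser; Pad])
     | b <- enum {: bool}] ++
  [seq ([:: Writer; Prog (Copy b); Pad], [:: Prog (Copy b); Data b; Writer])
     | b <- enum {: bool}] ++
  [:: ([:: Prog Start; Pad], [:: Prog Start; Eraser]);
      ([:: Eraser; Prog Middle], [:: Prog Middle; Writer]);
      ([:: Writer; Prog Stop], [:: Prog Stop; Pad])].

Variant universal_rel_spec : word uletter -> word uletter -> Prop :=
| URPad x : universal_rel_spec [:: Pad; x] [:: x; Pad]
| URComm p b : universal_rel_spec [:: Prog p; Data b] [:: Data b; Prog p]
| URErase b : universal_rel_spec [:: Eraser; Prog (Copy b); Data b]
                                 [:: Prog (Copy b); Eraser; Pad]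
| URWrite b : universal_rel_spec [:: Writer; Prog (Copy b); Pad]
                                 [:: Prog (Copy b); Data b; Writer]
| URStart : universal_rel_spec [:: Prog Start; Pad] [:: Prog Start; Eraser]
| URMiddle : universal_rel_spec [:: Eraser; Prog Middle]
                                [:: Prog Middle; Writer]
| URStop : universal_rel_spec [:: Writer; Prog Stop] [:: Prog Stop; Pad].

Lemma universal_relP u v :
  (u, v) \in universal_rel <-> universal_rel_spec u v.
Proof.
rewrite /universal_rel !mem_cat; split.
  case/or4P=> [/mapP[x _ [-> ->]]|/allpairsP[[p b] [_ _ [-> ->]]]
              |/mapP[b _ [-> ->]]|]; try by constructor.
  case/orP=> [/mapP[b _ [-> ->]]|]; first by constructor.
  by rewrite !inE => /or3P[] /eqP[-> ->]; constructor.
case=> [x|p b|b|b|||].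
- by rewrite (map_f (fun x => ([:: Pad; x], [:: x; Pad]))) ?mem_enum.
- by rewrite (allpairs_f (fun p b =>
    ([:: Prog p; Data b], [:: Data b; Prog p]))) ?mem_enum ?orbT.
- by rewrite (map_f (fun b => ([:: Eraser; Prog (Copy b); Data b],
    [:: Prog (Copy b); Eraser; Pad]))) ?mem_enum ?orbT.
- by rewrite (map_f (fun b => ([:: Writer; Prog (Copy b); Pad],
    [:: Prog (Copy b); Data b; Writer]))) ?mem_enum ?orbT.
- by rewrite !inE eqxx ?orbT.
- by rewrite !inE eqxx ?orbT.
- by rewrite !inE eqxx ?orbT.
Qed.

Lemma universal_rel_homogeneous : homogeneous universal_rel.
Proof. by move=> u v /universal_relP[]. Qed.

Local Notation ucong := (congruence_gen universal_rel).

Lemma ucong_pad n u : ucong (nseq n Pad ++ u) (u ++ nseq n Pad).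
Proof.
have pad1 w : ucong (Pad :: w) (rcons w Pad).
  elim: w => [|x w IH] /=; first exact: cong_refl.
  apply: (@cong_trans _ _ _ (x :: Pad :: w)).
    by apply: (@cong_rel_ctx _ _ [::] w [:: Pad; x] [:: x; Pad]);
       apply/universal_relP; constructor.
  by apply: (@cong_cat _ _ [:: x] [:: x]) => //; apply: cong_refl.
elim: n u => [|n IH] u; first by rewrite cats0; apply: cong_refl.
apply: (@cong_trans _ _ _ (Pad :: (u ++ nseq n Pad))).
  by apply: (@cong_cat _ _ [:: Pad] [:: Pad]) => //; apply: cong_refl.
apply: (cong_trans (pad1 _)).
by rewrite -cats1 -catA -(nseqD n 1) addn1; apply: cong_refl.
Qed.

(** As [Pad] is central, this is equality in the quotient of the universal monoid by [Pad] = 1. *)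
Definition padeq (u v : word uletter) : Prop :=
  exists i j, ucong (u ++ nseq i Pad) (v ++ nseq j Pad).

Lemma padeq_refl u : padeq u u.
Proof. by exists 0, 0; apply: cong_refl. Qed.

Lemma padeq_sym u v : padeq u v -> padeq v u.
Proof. by case=> i [j uv]; exists j, i; apply: cong_sym. Qed.

Lemma padeq_trans v u w : padeq u v -> padeq v w -> padeq u w.
Proof.
case=> i [j uv] [k [l vw]]; exists (i + k), (l + j).
rewrite !nseqD !catA; apply: (cong_trans (cong_cat uv (cong_refl _ _))).
rewrite -(catA v) -nseqD (addnC j) nseqD catA.
by apply: (cong_cat vw); apply: cong_refl.
Qed.

Lemma padeq_cat u u' v v' :
  padeq u u' -> padeq v v' -> padeq (u ++ v) (u' ++ v').
Proof.
case=> i [j uu'] [k [l vv']]; exists (i + k), (j + l).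
have push w w' m n : ucong ((w ++ w') ++ nseq (m + n) Pad)
    ((w ++ nseq m Pad) ++ (w' ++ nseq n Pad)).
  rewrite nseqD -!catA; apply: cong_cat; first exact: cong_refl.
  rewrite !catA; apply: cong_cat; last exact: cong_refl.
  exact: cong_sym (ucong_pad _ _).
apply: (cong_trans (push _ _ _ _)); apply: cong_sym.
apply: (cong_trans (push _ _ _ _)); apply: cong_sym.
exact: cong_cat.
Qed.

Lemma padeq_catl u v v' : padeq v v' -> padeq (u ++ v) (u ++ v').
Proof. exact: padeq_cat (padeq_refl u). Qed.

Lemma padeq_catr u u' v : padeq u u' -> padeq (u ++ v) (u' ++ v).
Proof. by move=> uu'; apply: padeq_cat uu' (padeq_refl v). Qed.

Lemma padeq_prog_data (p : seq pletter) (d : seq bool) :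
  padeq (map Prog p ++ map Data d) (map Data d ++ map Prog p).
Proof.
elim: p => [|a p IH]; first by rewrite cats0; apply: padeq_refl.
apply: (@padeq_trans ([:: Prog a] ++ map Data d ++ map Prog p)).
  exact: (@padeq_catl [:: Prog a]).
rewrite [map Prog (a :: p)]/= -(cat1s _ (map Prog p)) !catA.
apply: padeq_catr.
elim: d {IH} => [|b d IHd]; first exact: padeq_refl.
apply: (@padeq_trans ([:: Data b] ++ [:: Prog a] ++ map Data d)).
  apply: (@padeq_catr [:: Prog a; Data b] [:: Data b; Prog a]); exists 0, 0.
  by apply: cong_rel; apply/universal_relP; constructor.
exact: (@padeq_catl [:: Data b]).
Qed.

Lemma padeq_erase u :
  padeq (Eraser :: map Prog (map Copy u) ++ map Data u)
        (map Prog (map Copy u) ++ [:: Eraser]).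
Proof.
elim: u => [|b u IH]; first exact: padeq_refl.
(* The first data letter commutes to the left past the remaining copies, to meet its own [Copy]. *)
apply: (@padeq_trans ([:: Eraser; Prog (Copy b); Data b] ++
                      map Prog (map Copy u) ++ map Data u)).
  have := padeq_catl [:: Eraser; Prog (Copy b)]
    (padeq_catr (map Data u) (padeq_prog_data (map Copy u) [:: b])).
  by rewrite -!catA.
apply: (@padeq_trans ([:: Prog (Copy b); Eraser] ++
                      map Prog (map Copy u) ++ map Data u)).
  apply: (@padeq_catr _ [:: Prog (Copy b); Eraser]); exists 0, 1.
  by apply: cong_rel; apply/universal_relP; constructor.
exact: (@padeq_catl [:: Prog (Copy b)]).
Qed.

Lemma padeq_write v :
  padeq (Writer :: map Prog (map Copy v))
        (map Prog (map Copy v) ++ map Data v ++ [:: Writer]).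
Proof.
elim: v => [|b v IH]; first exact: padeq_refl.
apply: (@padeq_trans ([:: Prog (Copy b); Data b; Writer] ++
                      map Prog (map Copy v))).
  apply: (@padeq_catr [:: Writer; Prog (Copy b)]
            [:: Prog (Copy b); Data b; Writer]); exists 1, 0.
  by apply: cong_rel; apply/universal_relP; constructor.
apply: (@padeq_trans ([:: Prog (Copy b); Data b] ++
                      map Prog (map Copy v) ++ map Data v ++ [:: Writer])).
  exact: (@padeq_catl [:: Prog (Copy b); Data b]).
(* The letter just written moves right past the remaining copies and joins the later ones in the
   order of [v]. *)
apply: (@padeq_catl [:: Prog (Copy b)]).
have := padeq_catr (map Data v ++ [:: Writer])
  (padeq_sym (padeq_prog_data (map Copy v) [:: b])).
by rewrite -!catA.
Qed.

Lemma padeq_start : padeq [:: Prog Start] [:: Prog Start; Eraser].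
Proof. by exists 1, 0; apply: cong_rel; apply/universal_relP; constructor. Qed.

Lemma padeq_middle : padeq [:: Eraser; Prog Middle] [:: Prog Middle; Writer].
Proof. by exists 0, 0; apply: cong_rel; apply/universal_relP; constructor. Qed.

Lemma padeq_stop : padeq [:: Writer; Prog Stop] [:: Prog Stop].
Proof. by exists 0, 1; apply: cong_rel; apply/universal_relP; constructor. Qed.

(** A cursor born at [Start] erases [u], changes into a [Writer] at [Middle], writes [v] and
    dissolves at [Stop]. *)
Lemma padeq_substitute (u v : seq bool) (P := map Prog
    (Start :: map Copy u ++ Middle :: map Copy v ++ [:: Stop])) :
  padeq (P ++ map Data u) (P ++ map Data v).
Proof.
rewrite {}/P; set cu := map Prog (map Copy u); set cv := map Prog (map Copy v).
set du := map Data u; set dv := map Data v.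
have eP : map Prog (Start :: map Copy u ++ Middle :: map Copy v ++ [:: Stop]) =
    [:: Prog Start] ++ cu ++ [:: Prog Middle] ++ cv ++ [:: Prog Stop].
  by rewrite /= map_cat /= map_cat.
set tail := [:: Prog Middle] ++ cv ++ [:: Prog Stop].
have eT : tail = map Prog (Middle :: map Copy v ++ [:: Stop]).
  by rewrite /= map_cat.
rewrite {}eP -!catA -/tail.
(* The data [u] commutes left past the tail of the rule, to where the [Eraser] meets it. *)
apply: (@padeq_trans ([:: Prog Start; Eraser] ++ cu ++ du ++ tail)).
  apply: padeq_cat padeq_start _; apply: padeq_catl.
  have := padeq_prog_data (Middle :: map Copy v ++ [:: Stop]) u.
  by rewrite -eT /tail -!catA.
apply: (@padeq_trans ([:: Prog Start] ++ cu ++ [:: Eraser; Prog Middle] ++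
                      cv ++ [:: Prog Stop])).
  apply: (@padeq_catl [:: Prog Start]).
  have := padeq_catr tail (padeq_erase u).
  by rewrite /= -!catA.
do 2 apply: padeq_catl.
apply: (padeq_trans (padeq_catr _ padeq_middle)).
apply: (@padeq_catl [:: Prog Middle]).
have := padeq_catr [:: Prog Stop] (padeq_write v).
rewrite -/cv -/dv -catA => /padeq_trans; apply.
rewrite -!catA; apply: padeq_catl.
apply: (padeq_trans (padeq_catl _ padeq_stop)).
exact: padeq_sym (padeq_prog_data [:: Stop] v).
Qed.

(** * Interpreting a presentation *)

Section Program.
Variables (T : countType) (rules : seq (word T * word T)).

(** A self-delimiting unary code. The successor keeps the count 0 free, so that the two adjacent
    [true] between consecutive codes apply no letter. *)
Definition code (x : T) : seq bool :=
  true :: rcons (nseq (pickle x).+1 false) true.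

Definition codes (u : seq T) : seq bool := flatten (map code u).

Definition rule_word (r : seq T * seq T) : seq pletter :=
  Start :: map Copy (codes r.1) ++ Middle :: map Copy (codes r.2) ++ [:: Stop].

Definition program : seq pletter := flatten (map rule_word rules).

Lemma codes_cat u v : codes (u ++ v) = codes u ++ codes v.
Proof. by rewrite /codes map_cat flatten_cat. Qed.

Lemma codes1 x : codes [:: x] = code x.
Proof. exact: cats0. Qed.

Lemma padeq_program u v : congruence_gen rules u v ->
  padeq (map Prog program ++ map Data (codes u))
        (map Prog program ++ map Data (codes v)).
Proof.
elim=> {u v} [u v uv|u|u v _|u v w _ IHu _|u u' v v' _ IHu _ IHv].
- have [s1 [s2 ->]] : exists s1 s2,
      program = s1 ++ rule_word (u, v) ++ s2.
    rewrite /program; move: uv; elim: rules => // r rs IH.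
    rewrite inE => /orP[/eqP <-|/IH[s1 [s2 /= ->]]].
      by exists [::], (flatten (map rule_word rs)).
    by exists (rule_word r ++ s1), s2; rewrite /= -!catA.
  (* The rules listed after this one commute with the data, which brings its text next to the
     data. *)
  rewrite !map_cat -!catA; apply: padeq_catl.
  apply: (padeq_trans (padeq_catl _ (padeq_prog_data _ _))).
  apply: padeq_sym.
  apply: (padeq_trans (padeq_catl _ (padeq_prog_data _ _))).
  apply: padeq_sym; rewrite !catA; apply: padeq_catr.
  exact: padeq_substitute.
- exact: padeq_refl.
- exact: padeq_sym.
- exact: padeq_trans IHu.
- rewrite !codes_cat !map_cat.
  (* The left factor is rewritten next to the program; then the program passes it to reach the right
     factor. *)
  apply: (@padeq_trans (map Prog program ++ map Data (codes u') ++
                        map Data (codes v))).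
    by rewrite !catA; apply: padeq_catr.
  rewrite !catA.
  apply: (padeq_trans (padeq_catr _ (padeq_prog_data _ _))).
  apply: padeq_sym.
  apply: (padeq_trans (padeq_catr _ (padeq_prog_data _ _))).
  by apply: padeq_sym; rewrite -!catA; apply: padeq_catl.
Qed.

(** * An evaluation of words invariant under padding *)

Fixpoint lead (p : seq pletter) : seq bool :=
  if p is Copy b :: p' then b :: lead p' else [::].

(* The data word a cursor stands for, when the program letters to its left
   are [done], respectively to its right are [todo] *)
Definition eraser_value (done : seq pletter) : seq bool :=
  rev (lead (rev done)).
Definition writer_value (todo : seq pletter) : seq bool := lead todo.

Lemma lead_copy u p : lead (map Copy u ++ p) = u ++ lead p.
Proof. by elim: u => //= b u ->. Qed.

Lemma lead_stop p q : lead (p ++ Stop :: q) = lead p.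
Proof. by elim: p => //= -[b|||] p //= ->. Qed.

Lemma copy_middle_split u p d q :
  map Copy u ++ p = d ++ Middle :: q ->
  exists2 d', d = map Copy u ++ d' & p = d' ++ Middle :: q.
Proof.
elim: u d => [|b u IH] [|a d] //=; try by [exists [::] | exists (a :: d)].
by case=> <- /IH[d' -> ->]; exists d'.
Qed.

(** This makes the exchange of cursors at [Middle] sound. As [Start] and [Stop] delimit each rule
    text, the copy runs on the two sides of a [Middle] belong to a single rule. *)
Lemma program_middle d q : program = d ++ Middle :: q ->
  exists2 r, r \in rules &
    eraser_value d = codes r.1 /\ writer_value q = codes r.2.
Proof.
rewrite /program; elim: rules d => [|r rs IH] [|a d] //= [<-].
rewrite -!catA /= => /copy_middle_split[[|a' d'] -> [] //].
  rewrite -!catA cats0 => <-; exists r; first exact: mem_head.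
  split; last by rewrite /writer_value lead_copy cats0.
  by rewrite /eraser_value rev_cons -map_rev -cats1 lead_copy cats0 revK.
move=> <-; rewrite -!catA => /copy_middle_split[[|a2 d2] -> [] //] <- /IH.
case=> r' r'rs [dr qr]; exists r'; first by rewrite inE r'rs orbT.
split=> //; rewrite -dr /eraser_value; congr rev.
rewrite rev_cons rev_cat rev_cons rev_cat rev_cons -!cats1 -!catA.
exact: lead_stop.
Qed.

Variables (S : Type) (op : T -> S -> S) (init : S) (acc : S -> bool).
Hypothesis op_rules :
  forall u v s, (u, v) \in rules -> foldr op s u = foldr op s v.
Hypothesis rules_nonempty :
  forall u v, (u, v) \in rules -> u != [::] /\ v != [::].

(* Decoding from right to left: [false] increments the counter, [true] applies
   the letter with the counted index, if any, and resets the counter. *)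
Definition data_op (b : bool) (sn : S * nat) : S * nat :=
  let: (s, n) := sn in
  if b then (if n is n'.+1 then (if unpickle n' is Some x then op x s else s)
             else s, 0)
  else (s, n.+1).

(** The last [true] of the code flushes any count left over from the right, so the first one applies
    exactly [x]. *)
Lemma data_op_code x sn :
  foldr data_op sn (code x) = (op x (data_op true sn).1, 0).
Proof.
rewrite /code /= -cats1 foldr_cat [foldr _ _ [:: true]]/=.
have -> : data_op true sn = ((data_op true sn).1, 0) by case: sn.
move: (data_op true sn).1 => s {sn}.
have cnt n m : foldr data_op (s, n) (nseq m false) = (s, m + n).
  by elim: m => //= m ->.
by rewrite cnt addn0 /= pickleK.
Qed.

Lemma data_op_codes u s : foldr data_op (s, 0) (codes u) = (foldr op s u, 0).
Proof.
elim: u => // x u IH.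
by rewrite -cat1s codes_cat codes1 !foldr_cat IH data_op_code.
Qed.

(** Nonemptiness matters when a count is pending: the code of a letter flushes it, whereas the empty
    word would leave it as it is. *)
Lemma data_op_codes_nonempty u sn : u != [::] ->
  foldr data_op sn (codes u) = (foldr op (data_op true sn).1 u, 0).
Proof.
case/lastP: u => // u x _; rewrite -cats1 codes_cat codes1 !foldr_cat.
by rewrite data_op_code data_op_codes.
Qed.

Lemma data_op_rules u v sn : (u, v) \in rules ->
  foldr data_op sn (codes u) = foldr data_op sn (codes v).
Proof.
move=> uv; have [un vn] := rules_nonempty uv.
by rewrite !data_op_codes_nonempty // (op_rules _ uv).
Qed.

(** What has been read, from right to left, since the nearest [Close]: the program letters, which
    must form a suffix of [program], and the decoder state of the data. [None] stands for a
    malformed block or a position outside brackets. *)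
Definition block : Type := option (seq pletter * (S * nat)).

(** Because [p] is a suffix of [program], [take] yields the program text that must still follow on
    the left of the cursor for the block to be accepted; this gives the cursor a value before that
    text is read. *)
Definition block_op (x : uletter) (B : block) : block :=
  if B is Some (p, sn) then
    match x with
    | Data b => Some (p, data_op b sn)
    | Prog a => if suffix (a :: p) program then Some (a :: p, sn) else None
    | Eraser => Some (p, foldr data_op sn
        (eraser_value (take (size program - size p) program)))
    | Writer => Some (p, foldr data_op sn (writer_value p))
    | _ => B
    end
  else None.

Definition accepting (B : block) : bool :=
  if B is Some (p, (s, _)) then (p == program) && acc s else false.

(* The first component counts the accepting factors [Open w Close]. *)
Definition word_op (x : uletter) (nB : nat * block) : nat * block :=
  let: (n, B) := nB in
  match x with
  | Open => (n + accepting B, None)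
  | Close => (n, Some ([::], (init, 0)))
  | _ => (n, block_op x B)
  end.

Lemma take_suffix (d p : seq pletter) :
  program = d ++ p -> take (size program - size p) program = d.
Proof. by move=> ->; rewrite size_cat addnK take_size_cat. Qed.

Lemma word_op_rel u v nB :
  (u, v) \in universal_rel -> foldr word_op nB u = foldr word_op nB v.
Proof.
case: nB => n B /universal_relP[[b|p|||||]|a b|b|b|||];
  case: B => [[p' sn]|] //=.
- by case: ifP.
- by case: suffixP => // -[d ed].
(* Once the [Eraser] has crossed [Copy b], its value ends in [b], which makes up for the erased data
   letter. *)
- case: suffixP => //= -[d ed]; rewrite (take_suffix ed).
  have ed' : program = (d ++ [:: Copy b]) ++ p' by rewrite -catA.
  rewrite (take_suffix ed') /eraser_value rev_cat /= rev_cons -cats1.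
  by rewrite foldr_cat.
- by case: suffixP.
(* Right after [Start] nothing has been erased, so the [Eraser] acts trivially, like [Pad]. *)
- case: suffixP => //= -[d ed].
  have ed' : program = (d ++ [:: Start]) ++ p' by rewrite -catA.
  by rewrite (take_suffix ed') /eraser_value rev_cat.
(* At [Middle] the cursor values are the codes of the two sides of a rule, which act alike. *)
- case: suffixP => //= -[d ed]; rewrite (take_suffix ed).
  have [[r1 r2] /= rr [-> ->]] := program_middle ed.
  by rewrite (data_op_rules _ rr).
- by case: suffixP.
Qed.

Lemma word_op_padeq u v :
  padeq u v -> forall nB, foldr word_op nB u = foldr word_op nB v.
Proof.
case=> i [j uv] nB; have := cong_foldr word_op_rel uv nB.
have pads k : foldr word_op nB (nseq k Pad) = nB.
  by case: nB => n [[p sn]|]; elim: k => //= k ->.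
by rewrite !foldr_cat !pads.
Qed.

Lemma word_op_shift k u n B : foldr word_op (k + n, B) u =
  (k + (foldr word_op (n, B) u).1, (foldr word_op (n, B) u).2).
Proof.
elim: u => //= x u ->; case: (foldr _ _ u) => n' B'.
by case: x => //=; rewrite addnA.
Qed.

Lemma word_op_block w nB :
  foldr word_op nB
    (Open :: map Prog program ++ map Data (codes w) ++ [:: Close]) =
  (nB.1 + acc (foldr op init w), None).
Proof.
case: nB => n B; rewrite [foldr _ _ (_ :: _)]/= !foldr_cat /=.
have -> : forall d sn, foldr word_op (n, Some ([::], sn)) (map Data d) =
    (n, Some ([::], foldr data_op sn d)).
  by elim=> //= b d IH sn; rewrite IH.
rewrite data_op_codes.
set sn := (_, 0).
have read d p : program = d ++ p ->
    foldr word_op (n, Some ([::], sn)) (map Prog p) = (n, Some (p, sn)).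
  elim: p d => //= a p IH d ed.
  by rewrite (IH (d ++ [:: a])) -?catA // /= ed suffix_suffix.
by rewrite (read [::] program erefl) /= eqxx.
Qed.

(** A bracketed factor leaves the state [None], so on both sides [g] is evaluated from [None] and
    contributes the same count. Cancelling it leaves the contributions of the two bracketed
    factors. *)
Lemma o_conj_acc w1 w2 x1 x2 g :
  padeq x1 (map Prog program ++ map Data (codes w1)) ->
  padeq x2 (map Prog program ++ map Data (codes w2)) ->
  ucong ((Open :: x1 ++ [:: Close]) ++ g) (g ++ (Open :: x2 ++ [:: Close])) ->
  acc (foldr op init w1) = acc (foldr op init w2).
Proof.
have eval w x nB : padeq x (map Prog program ++ map Data (codes w)) ->
    foldr word_op nB (Open :: x ++ [:: Close]) =
      (nB.1 + acc (foldr op init w), None).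
  move=> xw; rewrite -word_op_block catA; apply: word_op_padeq.
  by apply: (@padeq_catl [:: Open]); apply: padeq_catr.
move=> xw1 xw2 /(cong_foldr word_op_rel)/(_ (0, None)).
rewrite !foldr_cat (eval _ _ _ xw1) (eval _ _ _ xw2) add0n.
rewrite -(addn0 (acc (foldr op init w2))) word_op_shift => -[/eqP].
rewrite addnC eqn_add2r => /eqP.
by do 2 case: acc.
Qed.

End Program.

(** * Words that carry their own program as data *)

Section Interleave.
Variable T : countType.

Definition data (u : seq T) : seq uletter := map Data (codes u).

Lemma data_cat u v : data (u ++ v) = data u ++ data v.
Proof. by rewrite /data codes_cat map_cat. Qed.

(* Padding gives [padded x y] and [padded y x] the same length. *)
Definition padded (x y : T) : seq uletter :=
  data [:: x] ++ nseq (size (codes [:: y])) Pad.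

Lemma padded_size x y : size (padded x y) = size (padded y x).
Proof.
by rewrite /padded !(size_cat (data _)) /data !size_map !size_nseq addnC.
Qed.

(** Pairing each program letter with its data letter makes the text of the whole word a
    letter-by-letter substitution of the program, which rewriting rules can carry out locally. *)
Definition segment (f : pletter -> T) (p : pletter) : seq uletter :=
  Prog p :: data [:: f p].

Definition interleaved (f : pletter -> T) (ps : seq pletter) (x y : T)
    (t : seq T) : seq uletter :=
  padded x y ++ flatten (map (segment f) ps) ++ data t.

Lemma padeq_interleaved f ps x y t :
  padeq (interleaved f ps x y t)
        (map Prog ps ++ data (x :: map f ps ++ t)).
Proof.
have segs : padeq (flatten (map (segment f) ps))
    (map Prog ps ++ data (map f ps)).
  elim: ps => [|p ps IH]; first exact: padeq_refl.
  apply: (@padeq_trans (segment f p ++ map Prog ps ++ data (map f ps))).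
    exact: padeq_catl.
  have := padeq_catl [:: Prog p] (padeq_catr (data (map f ps))
    (padeq_sym (padeq_prog_data ps (codes [:: f p])))).
  by rewrite (data_cat [:: f p] (map f ps) : data (map f (p :: ps)) = _) -!catA.
have pads : padeq (padded x y) (data [:: x]).
  by exists 0, (size (codes [:: y])); rewrite cats0; apply: cong_refl.
apply: (padeq_trans (padeq_cat pads (padeq_catr _ segs))).
rewrite -(cat1s x (map f ps ++ t)) (data_cat [:: x]) (data_cat (map f ps)).
have := padeq_catr (data (map f ps) ++ data t)
  (padeq_sym (padeq_prog_data ps (codes [:: x]))).
by rewrite -!catA.
Qed.

Definition bracketed (f : pletter -> T) (ps : seq pletter) (x y : T)
    (t : seq T) : seq uletter :=
  Open :: interleaved f ps x y t ++ [:: Close].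

Lemma bracketed_size f ps x y t :
  size (bracketed f ps x y t) = size (bracketed f ps y x t).
Proof.
have sz w : size (Open :: w ++ [:: Close]) = (size w).+2.
  by rewrite /= size_cat addn1.
by rewrite /bracketed /interleaved !sz !(size_cat (padded _ _)) padded_size.
Qed.

Lemma map_bracketed G (h : uletter -> G) f ps x y t :
  map h (bracketed f ps x y t) =
  map h (Open :: padded x y) ++
  flatten (map (fun p => map h (segment f p)) ps) ++
  map h (data t ++ [:: Close]).
Proof.
rewrite /bracketed /interleaved -(catA (padded x y)) -(catA (flatten _)).
rewrite -(cat_cons Open (padded x y)).
rewrite (map_cat h (Open :: padded x y)) (map_cat h (flatten _)).
by rewrite map_flatten -map_comp.
Qed.

(** The encoded pair is regrouped around its two identical runs of segments, in the shape of the
    tape of [config_start] below. *)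
Lemma map_encode_bracketed G (h : option uletter -> G) f ps x y t
    (hs := map (fun a => h (Some a))) :
  map h (encode_pair (bracketed f ps x y t) (bracketed f ps y x t)) =
  hs (Open :: padded x y) ++
  flatten (map (fun p => hs (segment f p)) ps) ++
  (hs (data t ++ [:: Close]) ++ h None :: hs (Open :: padded y x)) ++
  flatten (map (fun p => hs (segment f p)) ps) ++
  hs (data t ++ [:: Close]).
Proof.
rewrite /encode_pair (map_cat h (map Some _)) map_cons -!map_comp.
rewrite !map_bracketed.
have shuffle (a b c d : seq G) e :
    (a ++ b ++ c) ++ e :: d ++ b ++ c = a ++ b ++ (c ++ e :: d) ++ b ++ c.
  by rewrite -!catA.
exact: shuffle.
Qed.

End Interleave.

(** * Simulating a Turing machine on its own program *)

Inductive tletter (Q G : Type) :=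
  | Sym of G | Head of Q
  (* [Both p] splits into the tape text of [p] and [Later p], which moves right
     to [Mid], where it is written a second time. *)
  | Both of pletter | Later of pletter
  | LeftEnd | RightEnd | Halt | Done | Begin | Seek | Back | Mid | End.

Arguments Sym {Q G}.
Arguments Head {Q G}.
Arguments Both {Q G}.
Arguments Later {Q G}.
Arguments LeftEnd {Q G}.
Arguments RightEnd {Q G}.
Arguments Halt {Q G}.
Arguments Done {Q G}.
Arguments Begin {Q G}.
Arguments Seek {Q G}.
Arguments Back {Q G}.
Arguments Mid {Q G}.
Arguments End {Q G}.

Section TletterCountable.
Variables Q G : countType.

Definition tletter_code (x : tletter Q G) : G + Q + (pletter + pletter) + nat :=
  match x with
  | Sym g => inl (inl (inl g))
  | Head q => inl (inl (inr q))
  | Both p => inl (inr (inl p))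
  | Later p => inl (inr (inr p))
  | LeftEnd => inr 0
  | RightEnd => inr 1
  | Halt => inr 2
  | Done => inr 3
  | Begin => inr 4
  | Seek => inr 5
  | Back => inr 6
  | Mid => inr 7
  | End => inr 8
  end.

Definition tletter_decode (x : G + Q + (pletter + pletter) + nat) :=
  match x with
  | inl (inl (inl g)) => Sym g
  | inl (inl (inr q)) => Head q
  | inl (inr (inl p)) => Both p
  | inl (inr (inr p)) => Later p
  | inr n => nth End
      [:: LeftEnd; RightEnd; Halt; Done; Begin; Seek; Back; Mid] n
  end.

Lemma tletter_codeK : cancel tletter_code tletter_decode.
Proof. by case. Qed.

HB.instance Definition _ := 
  Countable.copy (tletter Q G) (can_type tletter_codeK).

End TletterCountable.

Section Machine.
Variables (I : finType) (D : turing_machine I).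
Local Notation Q := (tm_state D).
Local Notation G := (tm_symbol D).
Local Notation blank := (tm_blank D).
Local Notation letter := (tletter Q G).

Variables (tape_begin tape_mid tape_end : seq G) (tape_prog : pletter -> seq G).

Definition syms : seq G -> seq letter := map Sym.

(** An accepting halt gets no rule, so that only rejection can lead to [Done]. *)
Definition step_rules (q : Q) (g : G) : seq (word letter * word letter) :=
  match tm_trans q g with
  | None => if tm_accept q then [::] else [:: ([:: Head q; Sym g], [:: Halt])]
  | Some (q', a, Stay) => [:: ([:: Head q; Sym g], [:: Head q'; Sym a])]
  | Some (q', a, MoveRight) => [:: ([:: Head q; Sym g], [:: Sym a; Head q'])]
  | Some (q', a, MoveLeft) =>
      ([:: LeftEnd; Head q; Sym g], [:: LeftEnd; Head q'; Sym blank; Sym a]) ::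
      [seq ([:: Sym b; Head q; Sym g], [:: Head q'; Sym b; Sym a])
         | b <- enum {: G}]
  end.

Definition prog_rules (p : pletter) : seq (word letter * word letter) :=
  [:: ([:: Both p], syms (tape_prog p) ++ [:: Later p]);
      ([:: Later p; Mid], Mid :: syms (tape_prog p));
      ([:: Done; Both p], [:: Done])] ++
  [seq ([:: Later p; Sym g], [:: Sym g; Later p]) | g <- enum {: G}].

Definition sym_rules (g : G) : seq (word letter * word letter) :=
  [:: ([:: Seek; Sym g], [:: Sym g; Seek]);
      ([:: Sym g; Back], [:: Back; Sym g]);
      ([:: Halt; Sym g], [:: Halt]);
      ([:: Sym g; Done], [:: Done])].

(** [Seek] goes right to [Mid], which it reaches only after every [Later] in between has been
    absorbed; it returns as [Back] and starts the machine at [LeftEnd]. After a rejection, [Halt]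
    clears the tape to its right and turns into [Done], which clears the left. [Done] also absorbs
    an unexpanded frame on its right. *)
Definition const_rules : seq (word letter * word letter) :=
  [:: ([:: Begin], LeftEnd :: Seek :: syms tape_begin);
      ([:: Seek; Mid], Back :: syms tape_mid);
      ([:: LeftEnd; Back], [:: LeftEnd; Head (tm_start D)]);
      ([:: End], syms tape_end ++ [:: RightEnd]);
      ([:: Halt; RightEnd], [:: Done]);
      ([:: LeftEnd; Done], [:: Done]);
      ([:: Done; Mid], [:: Done]);
      ([:: Done; End], [:: Done])].

Definition machine_rules : seq (word letter * word letter) :=
  const_rules ++
  flatten [seq prog_rules p | p <- enum {: pletter}] ++
  flatten [seq sym_rules g | g <- enum {: G}] ++
  [seq ([:: Head q; RightEnd], [:: Head q; Sym blank; RightEnd])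
     | q <- enum {: Q}] ++
  flatten [seq step_rules q g | q <- enum {: Q}, g <- enum {: G}].

Lemma machine_rulesP u v : (u, v) \in machine_rules <->
  [\/ (u, v) \in const_rules, exists p, (u, v) \in prog_rules p,
      exists g, (u, v) \in sym_rules g
    | (exists q, (u, v) =
        ([:: Head q; RightEnd], [:: Head q; Sym blank; RightEnd])) \/
      exists q g, (u, v) \in step_rules q g].
Proof.
rewrite /machine_rules !mem_cat; split.
  case/or4P=> [uv|/flatten_mapP[p _ uv]|/flatten_mapP[g _ uv]|/orP[]].
  - exact: Or41.
  - by apply: Or42; exists p.
  - by apply: Or43; exists g.
  - by case/mapP=> q _ uv; apply: Or44; left; exists q.
  - case/flattenP=> s /allpairsP[[q g] [_ _ ->]] uv.
    by apply: Or44; right; exists q, g.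
case=> [->//|[p uv]|[g uv]|[[q ->]|[q [g uv]]]].
- by apply/or4P/Or42/flatten_mapP; exists p; rewrite ?mem_enum.
- by apply/or4P/Or43/flatten_mapP; exists g; rewrite ?mem_enum.
- by apply/or4P/Or44/orP; left; rewrite map_f ?mem_enum.
- apply/or4P/Or44/orP; right; apply/flattenP; exists (step_rules q g) => //.
  by rewrite allpairs_f ?mem_enum.
Qed.

Local Notation mcong := (congruence_gen machine_rules).

Lemma mcong_const l r u v :
  (u, v) \in const_rules -> mcong (l ++ u ++ r) (l ++ v ++ r).
Proof. by move=> uv; apply/cong_rel_ctx/machine_rulesP/Or41. Qed.

Lemma mcong_prog p l r u v :
  (u, v) \in prog_rules p -> mcong (l ++ u ++ r) (l ++ v ++ r).
Proof. by move=> uv; apply/cong_rel_ctx/machine_rulesP/Or42; exists p. Qed.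

Lemma mcong_sym g l r u v :
  (u, v) \in sym_rules g -> mcong (l ++ u ++ r) (l ++ v ++ r).
Proof. by move=> uv; apply/cong_rel_ctx/machine_rulesP/Or43; exists g. Qed.

Lemma mcong_step q g l r u v :
  (u, v) \in step_rules q g -> mcong (l ++ u ++ r) (l ++ v ++ r).
Proof.
by move=> uv; apply/cong_rel_ctx/machine_rulesP/Or44; right; exists q, g.
Qed.

Lemma mcong_blank q l r :
  mcong (l ++ [:: Head q; RightEnd] ++ r)
        (l ++ [:: Head q; Sym blank; RightEnd] ++ r).
Proof. by apply/cong_rel_ctx/machine_rulesP/Or44; left; exists q. Qed.

(** * Runs of the machine as derivations *)

Definition rejecting (c : config D) : Prop :=
  exists n c', iter n (obind (@tm_step I D)) (Some c) = Some c' /\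
    tm_step c' = None /\ ~~ tm_accept (conf_state c').

(** Determinism gives both directions; both matter, as a congruence also applies step rules
    backwards. *)
Lemma rejecting_step c c1 : tm_step c = Some c1 -> rejecting c <-> rejecting c1.
Proof.
move=> cc1; split=> [[[|n] [c' [cc' [stop rej]]]]|[n [c' [cc' rest]]]].
- by case: cc' stop cc1 => <- ->.
- by exists n, c'; rewrite -cc' iterSr /= cc1.
- by exists n.+1, c'; rewrite iterSr /= cc1.
Qed.

Lemma rejecting_iter n c c' :
  iter n (obind (@tm_step I D)) (Some c) = Some c' ->
  rejecting c <-> rejecting c'.
Proof.
elim: n c => [c [->] //|n IH c]; rewrite iterSr /=.
case e: (tm_step c) => [c1|].
  by move=> /IH; apply: iff_trans (rejecting_step e).
suff -> : iter n (obind (@tm_step I D)) None = None by [].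
by elim: (n) => //= m ->.
Qed.

Lemma rejecting_halted c : tm_step c = None ->
  rejecting c <-> ~~ tm_accept (conf_state c).
Proof.
move=> stop; split=> [[[|n] [c' [cc' [_ rej]]]]|rej].
- by case: cc' => ->.
- move: cc'; rewrite iterSr /= stop.
  suff -> : iter n (obind (@tm_step I D)) None = None by [].
  by elim: n => //= n ->.
- by exists 0, c.
Qed.

Lemma rejecting_blank q l : rejecting (Config q l [::]) <->
                            rejecting (Config q l [:: blank]).
Proof.
case e: (tm_step (Config q l [::])) => [c|].
  have e' : tm_step (Config q l [:: blank]) = Some c by [].
  exact: iff_trans (rejecting_step e) (iff_sym (rejecting_step e')).
have e' : tm_step (Config q l [:: blank]) = None by [].
exact: iff_trans (rejecting_halted e) (iff_sym (rejecting_halted e')).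
Qed.

Definition config_word (c : config D) : seq letter :=
  LeftEnd :: syms (rev (tape_left c)) ++
  Head (conf_state c) :: syms (tape_right c) ++ [:: RightEnd].

Lemma mcong_config_blank q l :
  mcong (config_word (Config q l [::])) (config_word (Config q l [:: blank])).
Proof.
exact: (mcong_blank q (LeftEnd :: syms (rev l)) [::]).
Qed.

Lemma mcong_config_step c c1 :
  tm_step c = Some c1 -> mcong (config_word c) (config_word c1).
Proof.
case: c => q l r.
suff nonempty g r' : tm_step (Config q l (g :: r')) = Some c1 ->
    mcong (config_word (Config q l (g :: r'))) (config_word c1).
  case: r => [|g r']; last exact: nonempty.
  by move=> /(nonempty blank [::]); apply: cong_trans (mcong_config_blank _ _).
rewrite /tm_step /=; case tr: (tm_trans q g) => [[[q' a] []]|//] [<-].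
- rewrite /config_word /=.
  case: l => [|b l] /=.
    apply: (@mcong_step q g [::] _ [:: LeftEnd; Head q; Sym g]
      [:: LeftEnd; Head q'; Sym blank; Sym a]).
    by rewrite /step_rules tr mem_head.
  have := @mcong_step q g (LeftEnd :: syms (rev l)) (syms r' ++ [:: RightEnd])
    [:: Sym b; Head q; Sym g] [:: Head q'; Sym b; Sym a].
  rewrite rev_cons -cats1 /syms map_cat -catA; apply.
  by rewrite /step_rules tr inE map_f ?orbT ?mem_enum.
- have := @mcong_step q g (LeftEnd :: syms (rev l)) (syms r' ++ [:: RightEnd])
    [:: Head q; Sym g] [:: Sym a; Head q'].
  rewrite /config_word /= rev_cons -cats1 /syms map_cat -catA; apply.
  by rewrite /step_rules tr mem_head.
- apply: (@mcong_step q g (LeftEnd :: syms (rev l)) _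
    [:: Head q; Sym g] [:: Head q'; Sym a]).
  by rewrite /step_rules tr mem_head.
Qed.

Lemma mcong_config_halted c :
  tm_step c = None -> ~~ tm_accept (conf_state c) ->
  mcong (config_word c) [:: Done].
Proof.
case: c => q l r /= stop rej.
have eatl (s : seq G) : mcong (LeftEnd :: syms s ++ [:: Done]) [:: Done].
  elim/last_ind: s => [|s g IH].
    by apply: (@mcong_const [::] [::] [:: LeftEnd; Done] [:: Done]);
      rewrite !inE eqxx ?orbT.
  apply: cong_trans IH; rewrite /syms map_rcons -cats1 -catA.
  apply: (@mcong_sym g (LeftEnd :: syms s) [::] [:: Sym g; Done] [:: Done]).
  by rewrite !inE eqxx ?orbT.
have eatr (s : seq G) : mcong (Halt :: syms s ++ [:: RightEnd]) [:: Done].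
  elim: s => [|g s IH].
    by apply: (@mcong_const [::] [::] [:: Halt; RightEnd] [:: Done]);
      rewrite !inE eqxx ?orbT.
  apply: cong_trans IH.
  apply: (@mcong_sym g [::] _ [:: Halt; Sym g] [:: Halt]).
  by rewrite !inE eqxx ?orbT.
suff nonempty g r' : tm_trans q g = None ->
    mcong (config_word (Config q l (g :: r'))) [:: Done].
  case: r stop => [|g r'] /=; case tr: (tm_trans _ _) => [[[? ?] []]|] // _;
    last exact: nonempty.
  exact: cong_trans (mcong_config_blank _ _) (nonempty _ [::] tr).
move=> tr; apply: cong_trans (eatl (rev l)).
apply: (@cong_trans _ _ _ (LeftEnd :: syms (rev l) ++
                        Halt :: syms r' ++ [:: RightEnd])).
  apply: (@mcong_step q g (LeftEnd :: syms (rev l)) _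
    [:: Head q; Sym g] [:: Halt]).
  by rewrite /step_rules tr (negbTE rej) mem_head.
apply: (@cong_cat _ _ (LeftEnd :: syms (rev l)) (LeftEnd :: syms (rev l))).
  exact: cong_refl.
exact: eatr.
Qed.

Lemma mcong_config_rejecting c :
  rejecting c -> mcong (config_word c) [:: Done].
Proof.
case=> n [c' [cc' [stop rej]]]; elim: n c cc' => [|n IH] c.
  by case=> ->; apply: mcong_config_halted.
rewrite iterSr /=; case e: (tm_step c) => [c1|].
  by move=> /IH; apply: cong_trans (mcong_config_step e).
suff -> : iter n (obind (@tm_step I D)) None = None by [].
by elim: (n) => //= m ->.
Qed.

(** * Writing the initial tape *)

Definition tape_progs (ps : seq pletter) : seq G := flatten (map tape_prog ps).

Lemma tape_progs_cons p ps :
  tape_progs (p :: ps) = tape_prog p ++ tape_progs ps.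
Proof. by []. Qed.

Lemma syms_cat s t : syms (s ++ t) = syms s ++ syms t.
Proof. exact: map_cat. Qed.

Definition config_start (ps : seq pletter) : config D :=
  Config (tm_start D) [::]
    (tape_begin ++ tape_progs ps ++ tape_mid ++ tape_progs ps ++ tape_end).

Definition frame (x : letter) (ps : seq pletter) : seq letter :=
  x :: map Both ps ++ [:: Mid; End].

Lemma mcong_done ps : mcong (frame Done ps) [:: Done].
Proof.
elim: ps => [|p ps IH].
  apply: (@cong_trans _ _ _ [:: Done; End]).
    apply: (@mcong_const [::] [:: End] [:: Done; Mid] [:: Done]).
    by rewrite !inE eqxx ?orbT.
  apply: (@mcong_const [::] [::] [:: Done; End] [:: Done]).
  by rewrite !inE eqxx ?orbT.
apply: cong_trans IH.
apply: (@mcong_prog p [::] (map Both ps ++ [:: Mid; End])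
  [:: Done; Both p] [:: Done]).
by rewrite !inE eqxx ?orbT.
Qed.

Lemma mcong_swap (x : letter) (s : seq G) :
  (forall g, mcong [:: x; Sym g] [:: Sym g; x]) ->
  mcong (x :: syms s) (syms s ++ [:: x]).
Proof.
move=> xg; elim: s => [|g s IH]; first exact: cong_refl.
apply: (@cong_trans _ _ _ (Sym g :: x :: syms s)).
  exact: (@cong_ctx _ _ [::] (syms s) [:: x; Sym g] [:: Sym g; x]).
exact: (@cong_cat _ _ [:: Sym g] [:: Sym g]) (cong_refl _ _) IH.
Qed.

Lemma mcong_both ps :
  mcong (map Both ps) (syms (tape_progs ps) ++ map Later ps).
Proof.
elim: ps => [|p ps IH]; first exact: cong_refl.
apply: (@cong_trans _ _ _
    ((syms (tape_prog p) ++ [:: Later p]) ++ map Both ps)).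
  apply: (@mcong_prog p [::] _ [:: Both p]
    (syms (tape_prog p) ++ [:: Later p])).
  by rewrite !inE eqxx.
apply: (cong_trans (cong_cat (cong_refl _ _) IH)).
have := @mcong_swap (Later p) (tape_progs ps).
move=> /(_ _)/(@cong_ctx _ _ (syms (tape_prog p)) (map Later ps)).
rewrite tape_progs_cons syms_cat -!catA; apply.
move=> g.
apply: (@mcong_prog p [::] [::] [:: Later p; Sym g] [:: Sym g; Later p]).
by rewrite /prog_rules mem_cat
  (map_f (fun g => ([:: Later p; Sym g], [:: Sym g; Later p]))) ?mem_enum ?orbT.
Qed.

(** The letter nearest to [Mid] crosses first and each later crossing inserts its text directly
    after [Mid], so the order is preserved. *)
Lemma mcong_later ps :
  mcong (map Later ps ++ [:: Mid]) (Mid :: syms (tape_progs ps)).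
Proof.
elim: ps => [|p ps IH]; first exact: cong_refl.
apply: (cong_trans
  (@cong_cat _ _ [:: Later p] [:: Later p] _ _ (cong_refl _ _) IH)).
have := @mcong_prog p [::] (syms (tape_progs ps)) [:: Later p; Mid]
  (Mid :: syms (tape_prog p)).
rewrite tape_progs_cons syms_cat; apply.
by rewrite !inE eqxx ?orbT.
Qed.

Lemma mcong_start ps : mcong (frame Begin ps) (config_word (config_start ps)).
Proof.
set H := syms (tape_progs ps).
apply: (@cong_trans _ _ _ ((LeftEnd :: Seek :: syms tape_begin) ++
    (H ++ map Later ps) ++ [:: Mid] ++ (syms tape_end ++ [:: RightEnd]))).
  have begin : mcong [:: Begin] (LeftEnd :: Seek :: syms tape_begin).
    have := @mcong_const [::] [::] [:: Begin]
      (LeftEnd :: Seek :: syms tape_begin).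
    by rewrite !cats0; apply; rewrite mem_head.
  have fin : mcong [:: End] (syms tape_end ++ [:: RightEnd]).
    have := @mcong_const [::] [::] [:: End] (syms tape_end ++ [:: RightEnd]).
    by rewrite !cats0; apply; rewrite !inE eqxx ?orbT.
  apply: cong_cat begin (cong_cat (mcong_both ps) _).
  exact: cong_cat (cong_refl _ [:: Mid]) fin.
have seek s : mcong (Seek :: syms s) (syms s ++ [:: Seek]).
  apply: mcong_swap => g.
  apply: (@mcong_sym g [::] [::] [:: Seek; Sym g] [:: Sym g; Seek]).
  by rewrite mem_head.
have back s : mcong (syms s ++ [:: Back]) (Back :: syms s).
  apply/cong_sym/mcong_swap => g; apply: cong_sym.
  apply: (@mcong_sym g [::] [::] [:: Sym g; Back] [:: Back; Sym g]).
  by rewrite !inE eqxx orbT.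
have seek_mid : mcong [:: Seek; Mid] (Back :: syms tape_mid).
  have := @mcong_const [::] [::] [:: Seek; Mid] (Back :: syms tape_mid).
  by rewrite !cats0; apply; rewrite !inE eqxx ?orbT.
set B := syms (tape_begin ++ tape_progs ps).
set E := H ++ syms tape_end ++ [:: RightEnd].
apply: (@cong_trans _ _ _ ([:: LeftEnd; Seek] ++ B ++ [:: Mid] ++ E)).
  have := cong_ctx (LeftEnd :: Seek :: B) (syms tape_end ++ [:: RightEnd])
    (mcong_later ps).
  by rewrite /B /E syms_cat /= -!catA.
apply: (@cong_trans _ _ _ ([:: LeftEnd] ++ B ++ [:: Seek; Mid] ++ E)).
  have := cong_ctx [:: LeftEnd] ([:: Mid] ++ E)
    (seek (tape_begin ++ tape_progs ps)).
  by rewrite -!catA.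
apply: (@cong_trans _ _ _ ([:: LeftEnd] ++ B ++ (Back :: syms tape_mid) ++ E)).
  have := cong_ctx ([:: LeftEnd] ++ B) E seek_mid.
  by rewrite -!catA.
apply: (@cong_trans _ _ _ ([:: LeftEnd; Back] ++ B ++ syms tape_mid ++ E)).
  have := cong_ctx [:: LeftEnd] (syms tape_mid ++ E)
    (back (tape_begin ++ tape_progs ps)).
  by rewrite -!catA.
have := @mcong_const [::] (B ++ syms tape_mid ++ E) [:: LeftEnd; Back]
  [:: LeftEnd; Head (tm_start D)].
rewrite /config_word [rev _]/= /config_start [tape_right _]/= /B /E.
rewrite !syms_cat -!catA.
by apply; rewrite !inE eqxx ?orbT.
Qed.

(* Meaning of a suffix of a word over the machine alphabet: [Run F] is the
   truth value of "the machine rejects" as a function of the tape symbols to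
   the left, nearest first; in [Split s1 s2] the tape mark [Mid] stands between
   [s1] and [s2]. *)
Inductive meaning :=
  | Tape of seq G | Split of seq G & seq G | Run of (seq G -> bool).

Definition rejectb (c : config D) : bool := `[< rejecting c >].
Definition stuck : meaning := Run (fun=> false).

Definition sym_op (g : G) (s : meaning) : meaning :=
  match s with
  | Tape r => Tape (g :: r)
  | Split s1 s2 => Split (g :: s1) s2
  | Run F => Run (fun l => F (g :: l))
  end.

Definition later_op (p : pletter) (s : meaning) : meaning :=
  if s is Split s1 s2 then Split s1 (tape_prog p ++ s2) else stuck.

Definition left_op (s : meaning) : meaning :=
  if s is Run F then Run (fun=> F [::]) else stuck.

Definition seek_op (s : meaning) : meaning :=
  if s is Split s1 s2 then
    Run (fun l => rejectb (Config (tm_start D) [::]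
                             (rev l ++ s1 ++ tape_mid ++ s2)))
  else stuck.

(** [Begin], [Both] and [End] receive the meaning of their expansions. [Done] is true in every
    context because it absorbs its surroundings. *)
Definition letter_op (x : letter) (s : meaning) : meaning :=
  match x with
  | Sym g => sym_op g s
  | Head q =>
      if s is Tape r then Run (fun l => rejectb (Config q l r)) else stuck
  | Both p => foldr sym_op (later_op p s) (tape_prog p)
  | Later p => later_op p s
  | LeftEnd => left_op s
  | RightEnd => Tape [::]
  | Halt => if s is Tape _ then Run xpredT else stuck
  | Done => Run xpredT
  | Begin => left_op (seek_op (foldr sym_op s tape_begin))
  | Seek => seek_op s
  | Back => if s is Tape r then
              Run (fun l => rejectb (Config (tm_start D) [::] (rev l ++ r)))
            else stuck
  | Mid => if s is Tape r then Split [::] r else stuck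
  | End => Tape tape_end
  end.

Lemma foldr_syms w s : foldr letter_op s (syms w) = foldr sym_op s w.
Proof. by elim: w => //= g w ->. Qed.

Lemma foldr_sym_op w s : foldr sym_op s w =
  match s with
  | Tape r => Tape (w ++ r)
  | Split s1 s2 => Split (w ++ s1) s2
  | Run F => Run (fun l => F (catrev w l))
  end.
Proof. by elim: w s => [|g w IH] [r|s1 s2|F] //=; rewrite IH. Qed.

Lemma letter_op_rules u v s :
  (u, v) \in machine_rules -> foldr letter_op s u = foldr letter_op s v.
Proof.
case/machine_rulesP=> [|[p]|[g]|[[q [-> ->]]|[q [g]]]].
- rewrite !inE => /or4P[|||/or4P[|||/orP[]]] /eqP[-> ->];
    rewrite /= ?foldr_cat ?foldr_syms ?foldr_sym_op /= ?cats0 //.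
  + by case: s => //= r; rewrite foldr_syms foldr_sym_op.
  + by case: s.
- rewrite /prog_rules mem_cat => /orP[|/mapP[g _ [-> ->]]]; last by case: s.
  rewrite !inE => /or3P[] /eqP[-> ->] //=.
    by rewrite foldr_cat foldr_syms.
  by case: s => [r|s1 s2|F] /=; rewrite foldr_syms foldr_sym_op.
- rewrite !inE => /or4P[] /eqP[-> ->]; case: s => //= *; congr Run;
    apply: funext => l; by rewrite ?rev_cons -?cats1 -?catA.
- move=> /=; congr Run; apply: funext => l.
  by apply/asboolP/asboolP => /rejecting_blank.
- rewrite /step_rules; case tr: (tm_trans q g) => [[[q' a] m]|]; last first.
    (* The configuration is halted and rejecting whatever lies to the left, which agrees with the
       value true of [Halt]. *)
    case: ifP => // rej; rewrite inE => /eqP[-> ->].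
    case: s => //= r; congr Run; apply: funext => l.
    by apply/asboolP/rejecting_halted; rewrite /= ?tr ?rej.
  have step l r c1 : tm_step (Config q l (g :: r)) = Some c1 ->
      rejectb (Config q l (g :: r)) = rejectb c1.
    by move=> /rejecting_step e; apply/asboolP/asboolP => /e.
  case: m tr => tr; rewrite ?inE.
  + case/orP=> [/eqP[-> ->]|/mapP[b _ [-> ->]]]; case: s => //= r;
      congr Run; apply: funext => l; apply: step; by rewrite /= tr.
  + move=> /eqP[-> ->]; case: s => //= r; congr Run; apply: funext => l.
    by apply: step; rewrite /= tr.
  + move=> /eqP[-> ->]; case: s => //= r; congr Run; apply: funext => l.
    by apply: step; rewrite /= tr.
Qed.

Lemma machine_rules_nonempty u v :
  (u, v) \in machine_rules -> u != [::] /\ v != [::].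
Proof.
have rconsN (s : seq letter) x : s ++ [:: x] != [::] by case: s.
case/machine_rulesP=> [|[p]|[g]|[[q [-> ->]]|[q [g]]]] //.
- by rewrite !inE => /or4P[|||/or4P[|||/orP[]]] /eqP[-> ->].
- rewrite /prog_rules mem_cat => /orP[|/mapP[g _ [-> ->]]] //.
  by rewrite !inE => /or3P[] /eqP[-> ->].
- by rewrite !inE => /or4P[] /eqP[-> ->].
rewrite /step_rules; case: tm_trans => [[[q' a] []]|]; last by case: ifP => //;
  rewrite inE => _ /eqP[-> ->].
- by rewrite inE => /orP[/eqP[-> ->]|/mapP[b _ [-> ->]]].
- by rewrite inE => /eqP[-> ->].
- by rewrite inE => /eqP[-> ->].
Qed.

Definition accepts (s : meaning) : bool := if s is Run F then F [::] else false.

Lemma accepts_done ps : accepts (foldr letter_op (Tape [::]) (frame Done ps)).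
Proof. by []. Qed.

Lemma accepts_begin ps :
  accepts (foldr letter_op (Tape [::]) (frame Begin ps)) =
  rejectb (config_start ps).
Proof.
rewrite /frame [foldr _ _ (_ :: _)]/= foldr_cat /=.
have -> : foldr letter_op (Split [::] tape_end) (map Both ps) =
    Split (tape_progs ps) (tape_progs ps ++ tape_end).
  elim: ps => //= p ps ->; rewrite /= foldr_sym_op tape_progs_cons.
  by rewrite -catA.
by rewrite foldr_sym_op /= -!catA.
Qed.

(** If the words are o-conjugate, counting shows that [frame Begin ps] is accepted like
    [frame Done ps], which means rejection by the machine. Conversely, a rejecting run makes both
    frames congruent to [Done], hence the two words equal up to padding. *)
Lemma o_conjugate_rejecting (ps := program machine_rules)
    (machine_word := fun x y : letter => bracketed Both ps x y [:: Mid; End]) :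
  o_conjugate (word_class universal_rel (machine_word Begin Done))
              (word_class universal_rel (machine_word Done Begin)) <->
  rejecting (config_start ps).
Proof.
set X := machine_word Begin Done; set Y := machine_word Done Begin; split.
  case=> x [_ [+ _]]; have [g ->] := word_class_surj x.
  rewrite -!word_class_cat => /word_classP XgY.
  have := o_conj_acc (Tape [::]) accepts letter_op_rules
    machine_rules_nonempty
    (padeq_interleaved Both ps (Begin : letter) Done [:: Mid; End])
    (padeq_interleaved Both ps (Done : letter) Begin [:: Mid; End]) XgY.
  by rewrite -!/(frame _ _) accepts_begin accepts_done => /asboolP.
move=> rej; have [i [j XY]] : padeq X Y.
  apply: (@padeq_catl [:: Open]); apply: padeq_catr.
  apply: (padeq_trans (padeq_interleaved _ _ _ _ _)).
  apply: padeq_sym; apply: (padeq_trans (padeq_interleaved _ _ _ _ _)).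
  apply: padeq_sym; apply: padeq_program.
  apply: (cong_trans (mcong_start ps)).
  apply: (cong_trans (mcong_config_rejecting rej)).
  exact: cong_sym (mcong_done ps).
have sXY : size X = size Y by exact: bracketed_size.
clearbody X Y.
(* Equal lengths force equal amounts of padding, and this central power of [Pad] serves as both
   conjugators. *)
have := cong_size universal_rel_homogeneous XY.
rewrite !size_cat !size_nseq sXY => /addnI ij.
subst j; exists (word_class _ (nseq i Pad)), (word_class _ (nseq i Pad)).
rewrite -!word_class_cat; split; apply/word_classP.
  exact: cong_trans XY (cong_sym (ucong_pad _ _)).
exact: cong_trans (ucong_pad _ _) XY.
Qed.

End Machine.

(** * Diagonalisation *)

Section Diagonal.
Variable D : turing_machine (option uletter).
Local Notation letter := (tletter (tm_state D) (tm_symbol D)).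

Definition tape (u : seq uletter) : seq (tm_symbol D) :=
  map (fun x => tm_input D (Some x)) u.

Definition tape_tail : seq (tm_symbol D) :=
  tape (data [:: (Mid : letter); End] ++ [:: Close]).

Definition tape_head (x y : letter) : seq (tm_symbol D) :=
  tape (Open :: padded x y).

Definition tape_middle : seq (tm_symbol D) :=
  tape_tail ++ tm_input D None :: tape_head Done Begin.

Definition tape_segment (p : pletter) : seq (tm_symbol D) :=
  tape (segment (Both : pletter -> letter) p).

(** There is no circularity: the tape texts depend on [D] and on codes of single letters, not on the
    rules, so the program of these rules can afterwards be put into the words. *)
Definition diagonal_rules : seq (word letter * word letter) :=
  machine_rules (tape_head Begin Done) tape_middle tape_tail tape_segment.

Definition diagonal_word (x y : letter) : seq uletter :=
  bracketed Both (program diagonal_rules) x y [:: Mid; End].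

Definition diagonal_config : config D :=
  config_start (tape_head Begin Done) tape_middle tape_tail tape_segment
    (program diagonal_rules).

(** The self-reference closes here: the tape written by the rules is the input of [D] on the very
    pair being rewritten. *)
Lemma tm_init_diagonal :
  tm_init D (encode_pair (diagonal_word Begin Done) (diagonal_word Done Begin))
  = diagonal_config.
Proof.
exact: (congr1 (Config (tm_start D) [::])
  (map_encode_bracketed (@tm_input _ D) Both (program diagonal_rules)
     Begin Done [:: Mid; End])).
Qed.

Lemma not_decides : ~ tm_decides D (fun u v =>
  o_conjugate (word_class universal_rel u) (word_class universal_rel v)).
Proof.
move=> /(_ (diagonal_word Begin Done) (diagonal_word Done Begin))[c].
case=> -[[n]]; rewrite tm_init_diagonal => /rejecting_iter rejc stop accP.
have conj_rej := o_conjugate_rejecting (tape_head Begin Done) tape_middle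
  tape_tail tape_segment.
(* [D] accepts at [c] iff the pair is o-conjugate, iff the run on this pair rejects, iff [c] is
   rejecting. *)
have [accept_rej rej_accept] := iff_trans accP (iff_trans conj_rej rejc).
have [rej_naccept naccept_rej] := rejecting_halted stop.
case acc: (tm_accept (conf_state c)).
  by have := rej_naccept (accept_rej acc); rewrite acc.
by have := rej_accept (naccept_rej (negbT acc)); rewrite acc.
Qed.

End Diagonal.

Theorem theorem4p1 :
  exists (A : finType) (R : seq (word A * word A)),
    homogeneous R /\
    ~ turing_decidable
        (fun u v : word A => o_conjugate (word_class R u) (word_class R v)).
Proof.
exists uletter, universal_rel; split; first exact: universal_rel_homogeneous.
by case=> D; apply: not_decides.
Qed.
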